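(* Let $K$ be a field, let $E$ be a finite quiver and let $R$ be a $K$-subalgebra of $P((E))$ containing $P(E)$ and closed under inversion (in $P((E))$) and under all the transductions $\delta_e$ and $\tilde\delta_e$, $e\in E^1$. Set $S=R\langle\overline E;\tau,\delta\rangle$, $I=SqS$ and $T=S/I$. Then $T$ and $S$ are von Neumann regular.
   Context: $E=(E^0,E^1,r,s)$ is a finite quiver with $E^0=\{1,\dots,d\}$; $s(e)$ and $r(e)$ are the source and range of an arrow $e$. A path is a trivial path $p_i$ ($i\in E^0$, length $0$, $s(p_i)=r(p_i)=i$) or a sequence $e_1\cdots e_n$ of arrows with $r(e_t)=s(e_{t+1})$; its source is $s(e_1)$, its range $r(e_n)$. $E^*$ is the set of all paths. $P(E)$ is the path $K$-algebra (basis $E^*$, product by concatenation, $p_{s(e)}e=ep_{r(e)}=e$). $P((E))$ is the algebra of formal power series: possibly infinite sums $\sum_{\gamma\in E^*}\lambda_\gamma\gamma$, $\lambda_\gamma\in K$. $R$ is closed under inversion in $P((E))$ if every element of $R$ invertible in $P((E))$ is invertible in $R$. For $e\in E^1$ the left transduction $\delta_e$ (written on the right) is $(\sum_\alpha\lambda_\alpha\alpha)\delta_e=\sum_{r(\alpha)=s(e)}\lambda_{\alpha e}\alpha$, and the right transduction is $\tilde\delta_e(\sum_\alpha\lambda_\alpha\alpha)=\sum_{s(\alpha)=r(e)}\lambda_{e\alpha}\alpha$. Also $\tau_e$ (written on the right) is the $K$-algebra endomorphism interchanging $p_{s(e)}$ and $p_{r(e)}$, fixing $p_i$ for $i\ne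 s(e),r(e)$, and killing all series with no terms of length $0$. Inverse quiver $\overline E$: same vertices, arrows $\overline e$ ($e\in E^1$) with source $r(e)$ and range $s(e)$. $R\langle\overline E;\tau,\delta\rangle$ is the subring of $\mathrm{End}_K(R)$ (endomorphisms acting on the right) generated by the right multiplications by elements of $R$ and by the operators $\delta_e$, $e\in E^1$; $r\in R$ is identified with right multiplication by $r$ and $\overline e$ with $\delta_e$. Then $r\overline e=\overline e(r\tau_e)+(r\delta_e)$ for $r\in R$, $e\in E^1$. Let $X\subseteq E^0$ be the set of vertices that are not sources, i.e. with $r^{-1}(i)\ne\emptyset$. For $i\in X$ put $q_i=p_i-\sum_{e\in r^{-1}(i)}\overline e e$, and $q=\sum_{i\in X}q_i$. *)

(* Defs.v *)
From HB Require Import structures.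
From mathcomp Require Import all_boot all_order all_algebra.
From mathcomp Require Import boolp.

Set Implicit Arguments.
Unset Strict Implicit.
Unset Printing Implicit Defensive.

Import GRing.Theory.
Local Open Scope ring_scope.
Local Open Scope quotient_scope.

(* The zero ring is not excluded anywhere below (hence pzRingType): S / SqS   *)
(* may vanish, and P((E)) does when E has no vertex.                          *)

Definition von_neumann_regular (A : pzRingType) : Prop :=
  forall a : A, exists b : A, a * b * a = a.

Section GeneratedSubring.
Variables (A : pzRingType) (G : A -> Prop).

Definition gen_subring : {pred A} := fun x =>
  `[< forall B : {pred A}, GRing.subring_closed B ->
        (forall y, G y -> y \in B) -> x \in B >].

Lemma gen_subringP x :
  reflect (forall B : {pred A}, GRing.subring_closed B ->
             (forall y, G y -> y \in B) -> x \in B)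
          (x \in gen_subring).
Proof. exact: asboolP. Qed.

Lemma mem_gen_subring x : G x -> x \in gen_subring.
Proof. by move=> Gx; apply/gen_subringP => B _; apply. Qed.

Lemma gen_subring_closed : GRing.subring_closed gen_subring.
Proof.
split=> [|x y|x y].
- by apply/gen_subringP => B [].
- move=> /gen_subringP xB /gen_subringP yB; apply/gen_subringP => B Bc GB.
  by have [_ Bs _] := Bc; apply: Bs; [apply: xB | apply: yB].
- move=> /gen_subringP xB /gen_subringP yB; apply/gen_subringP => B Bc GB.
  by have [_ _ Bm] := Bc; apply: Bm; [apply: xB | apply: yB].
Qed.

Record gen_subring_of := GenSubring {
  gen_val :> A;
  gen_valP : gen_val \in gen_subring
}.

HB.instance Definition _ := [isSub for gen_val].
HB.instance Definition _ := [Choice of gen_subring_of by <:].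
HB.instance Definition _ :=
  GRing.SubChoice_isSubPzRing.Build A gen_subring gen_subring_of
    gen_subring_closed.

End GeneratedSubring.

Definition two_sided (A : pzRingType) (I : {pred A}) : Prop :=
  forall a x, x \in I -> (a * x \in I) && (x * a \in I).

HB.mixin Record isTwoSided (A : pzRingType) (I : A -> bool) := {
  two_sided_subproof : two_sided I
}.

#[short(type="twoSidedIdeal")]
HB.structure Definition TwoSidedIdeal (A : pzRingType) :=
  {I of GRing.ZmodClosed A I & isTwoSided A I}.

(* The additive quotient is the library's {ideal_quot I}; its ring structure there  *)
(* is restricted to proper ideals of commutative rings.                       *)
Section QuotientRing.
Variables (A : pzRingType) (I : twoSidedIdeal A).

Definition quotient_ring := {ideal_quot I}.

HB.instance Definition _ := Choice.on quotient_ring.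
HB.instance Definition _ := GRing.Zmodule.on quotient_ring.
HB.instance Definition _ : EqQuotient A (Quotient.equiv I) quotient_ring :=
  EqQuotient.on quotient_ring.

Definition quotient_one : quotient_ring := \pi_quotient_ring 1.
Definition quotient_mul (x y : quotient_ring) : quotient_ring :=
  \pi_quotient_ring (repr x * repr y).

Lemma quotient_eqP (x y : A) :
  reflect (\pi_quotient_ring x = \pi_quotient_ring y) (x - y \in I).
Proof. by rewrite Quotient.idealrBE; apply: eqP. Qed.

Lemma quotient_piM (x y : A) :
  \pi_quotient_ring (x * y) =
  quotient_mul (\pi_quotient_ring x) (\pi_quotient_ring y).
Proof.
apply/quotient_eqP; set x' := repr _; set y' := repr _.
have xI : x - x' \in I by apply/quotient_eqP; rewrite reprK.
have yI : y - y' \in I by apply/quotient_eqP; rewrite reprK.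
have -> : x * y - x' * y' = (x - x') * y + x' * (y - y').
  by rewrite mulrBl mulrBr addrA subrK.
by rewrite rpredD //; [case/andP: (two_sided_subproof y _ xI)
                      | case/andP: (two_sided_subproof x' _ yI)].
Qed.

Lemma quotient_piD (x y : A) :
  \pi_quotient_ring (x + y) =
  \pi_quotient_ring x + \pi_quotient_ring y :> quotient_ring.
Proof. exact: Quotient.pi_add. Qed.

Lemma quotient_mulA : associative quotient_mul.
Proof.
move=> x y z; elim/quotW: x => x; elim/quotW: y => y; elim/quotW: z => z.
by rewrite -(quotient_piM y z) -(quotient_piM x y) -!quotient_piM mulrA.
Qed.

Lemma quotient_mul1l : left_id quotient_one quotient_mul.
Proof. by elim/quotW=> x; rewrite -(quotient_piM 1 x) mul1r. Qed.

Lemma quotient_mul1r : right_id quotient_one quotient_mul.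
Proof. by elim/quotW=> x; rewrite -(quotient_piM x 1) mulr1. Qed.

Lemma quotient_mulDl : left_distributive quotient_mul +%R.
Proof.
move=> x y z; elim/quotW: x => x; elim/quotW: y => y; elim/quotW: z => z.
by rewrite -quotient_piD -!quotient_piM -quotient_piD mulrDl.
Qed.

Lemma quotient_mulDr : right_distributive quotient_mul +%R.
Proof.
move=> x y z; elim/quotW: x => x; elim/quotW: y => y; elim/quotW: z => z.
by rewrite -quotient_piD -!quotient_piM -quotient_piD mulrDr.
Qed.

HB.instance Definition _ :=
  GRing.Zmodule_isPzRing.Build quotient_ring
    quotient_mulA quotient_mul1l quotient_mul1r quotient_mulDl quotient_mulDr.

End QuotientRing.

(* The two-sided ideal A x A: finite sums of elements a x b. *)
Section PrincipalIdeal.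
Variables (A : pzRingType) (x : A).

Definition principal_ideal : {pred A} := fun y =>
  `[< exists s : seq (A * A), y = \sum_(ab <- s) ab.1 * x * ab.2 >].

Lemma principal_ideal_zmod : GRing.zmod_closed principal_ideal.
Proof.
split=> [|y z /asboolP[s ->] /asboolP[t ->]].
  by apply/asboolP; exists [::]; rewrite big_nil.
apply/asboolP; exists (s ++ [seq (- ab.1, ab.2) | ab <- t]).
rewrite big_cat big_map /= -sumrN; congr (_ + _).
by apply: eq_bigr => ab _; rewrite !mulNr.
Qed.

Lemma principal_ideal_two_sided : two_sided principal_ideal.
Proof.
move=> a y /asboolP[s ->]; apply/andP; split; apply/asboolP.
  exists [seq (a * ab.1, ab.2) | ab <- s]; rewrite big_map mulr_sumr.
  by apply: eq_bigr => ab _; rewrite !mulrA.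
exists [seq (ab.1, ab.2 * a) | ab <- s]; rewrite big_map mulr_suml.
by apply: eq_bigr => ab _; rewrite !mulrA.
Qed.

HB.instance Definition _ :=
  GRing.isZmodClosed.Build A principal_ideal principal_ideal_zmod.
HB.instance Definition _ :=
  isTwoSided.Build A principal_ideal principal_ideal_two_sided.

End PrincipalIdeal.

Section Endomorphisms.
Variables (K : pzRingType) (V : lmodType K).

Record endo := Endo { endo_fun :> V -> V; endo_linear : linear endo_fun }.

HB.instance Definition _ := gen_eqMixin endo.
HB.instance Definition _ := gen_choiceMixin endo.

Lemma endoP (f g : endo) : f =1 g -> f = g.
Proof.
case: f g => [f fL] [g gL] /= /funext fg; rewrite fg in fL *.
by congr Endo; apply: Prop_irrelevance.
Qed.

Lemma endoD (f : endo) x y : f (x + y) = f x + f y.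
Proof. by have := endo_linear f 1 x y; rewrite !scale1r. Qed.

Fact endo_zero_linear : linear (fun _ : V => 0 : V).
Proof. by move=> a x y; rewrite scaler0 addr0. Qed.
Fact endo_opp_linear (f : endo) : linear (fun x : V => - f x).
Proof. by move=> a x y; rewrite endo_linear opprD scalerN. Qed.
Fact endo_add_linear (f g : endo) : linear (fun x : V => f x + g x).
Proof. by move=> a x y; rewrite !endo_linear scalerDr addrACA. Qed.
Fact endo_one_linear : linear (fun x : V => x).
Proof. by []. Qed.
Fact endo_mul_linear (f g : endo) : linear (fun x : V => g (f x)).
Proof. by move=> a x y; rewrite !endo_linear. Qed.

Definition endo_zero := Endo endo_zero_linear.
Definition endo_opp f := Endo (endo_opp_linear f).
Definition endo_add f g := Endo (endo_add_linear f g).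
Definition endo_one := Endo endo_one_linear.
(* Endomorphisms act on the right: x (f g) = (x f) g. *)
Definition endo_mul f g := Endo (endo_mul_linear f g).

Fact endo_addA : associative endo_add.
Proof. by move=> f g h; apply: endoP => x /=; rewrite addrA. Qed.
Fact endo_addC : commutative endo_add.
Proof. by move=> f g; apply: endoP => x /=; rewrite addrC. Qed.
Fact endo_add0 : left_id endo_zero endo_add.
Proof. by move=> f; apply: endoP => x /=; rewrite add0r. Qed.
Fact endo_addN : left_inverse endo_zero endo_opp endo_add.
Proof. by move=> f; apply: endoP => x /=; rewrite addNr. Qed.

HB.instance Definition _ :=
  GRing.isZmodule.Build endo endo_addA endo_addC endo_add0 endo_addN.

Fact endo_mulA : associative endo_mul.
Proof. by move=> f g h; apply: endoP. Qed.
Fact endo_mul1l : left_id endo_one endo_mul.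
Proof. by move=> f; apply: endoP. Qed.
Fact endo_mul1r : right_id endo_one endo_mul.
Proof. by move=> f; apply: endoP. Qed.
Fact endo_mulDl : left_distributive endo_mul +%R.
Proof. by move=> f g h; apply: endoP => x /=; rewrite endoD. Qed.
Fact endo_mulDr : right_distributive endo_mul +%R.
Proof. by move=> f g h; apply: endoP. Qed.

HB.instance Definition _ := GRing.Zmodule_isPzRing.Build endo
  endo_mulA endo_mul1l endo_mul1r endo_mulDl endo_mulDr.

End Endomorphisms.

Record quiver := Quiver {
  vertex : finType;
  arrow : finType;
  src : arrow -> vertex;
  rng : arrow -> vertex
}.

Section Paths.
Variable E : quiver.

Fixpoint is_walk (i : vertex E) (w : seq (arrow E)) : bool :=
  if w is e :: w' then (src e == i) && is_walk (rng e) w' else true.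

(* A path is recorded with its source, so that the trivial paths (i, [::]) at *)
(* distinct vertices are distinct.                                            *)
Record qpath := QPath {
  walk_of :> vertex E * seq (arrow E);
  walk_ofP : is_walk walk_of.1 walk_of.2
}.

HB.instance Definition _ := [isSub for walk_of].
HB.instance Definition _ := [Countable of qpath by <:].

Definition walk_end (i : vertex E) (w : seq (arrow E)) : vertex E :=
  last i (map (@rng E) w).

Definition psrc (g : qpath) : vertex E := g.1.
Definition prng (g : qpath) : vertex E := walk_end g.1 g.2.
Definition plen (g : qpath) : nat := size g.2.

Lemma is_walk_cat i w1 w2 :
  is_walk i (w1 ++ w2) = is_walk i w1 && is_walk (walk_end i w1) w2.
Proof. by elim: w1 i => //= e w1 IH i; rewrite IH andbA. Qed.

Fact trivial_path_subproof (i : vertex E) :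
  let g := (i, [::] : seq (arrow E)) in is_walk g.1 g.2.
Proof. by []. Qed.
Definition trivial_path i : qpath := QPath (trivial_path_subproof i).

Fact arrow_path_subproof (e : arrow E) :
  let g := (src e, [:: e]) in is_walk g.1 g.2.
Proof. by rewrite /= eqxx. Qed.
Definition arrow_path e : qpath := QPath (arrow_path_subproof e).

(* Meaningful only when prng g = psrc h. *)
Definition pcat (g h : qpath) : qpath := insubd g (g.1, g.2 ++ h.2).

(* The factorizations of g are the pairs (pprefix k g, psuffix k g) for       *)
(* 0 <= k <= plen g.                                                          *)
Fact pprefix_subproof k (g : qpath) :
  let h := (g.1, take k g.2) in is_walk h.1 h.2.
Proof.
by have := walk_ofP g; rewrite -{1}(cat_take_drop k g.2) is_walk_cat => /andP[].
Qed.
Definition pprefix k g : qpath := QPath (pprefix_subproof k g).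

Fact psuffix_subproof k (g : qpath) :
  let h := (walk_end g.1 (take k g.2), drop k g.2) in is_walk h.1 h.2.
Proof.
by have := walk_ofP g; rewrite -{1}(cat_take_drop k g.2) is_walk_cat => /andP[].
Qed.
Definition psuffix k g : qpath := QPath (psuffix_subproof k g).

Lemma plen_prefix k g : (k <= plen g)%N -> plen (pprefix k g) = k.
Proof. exact: size_takel. Qed.

Lemma plen_suffix k g : plen (psuffix k g) = (plen g - k)%N.
Proof. exact: size_drop. Qed.

Lemma pprefix_prefix j k g : (j <= k)%N -> pprefix j (pprefix k g) = pprefix j g.
Proof. by move=> jk; apply: val_inj => /=; rewrite take_takel. Qed.

Lemma walk_end_cat i w1 w2 :
  walk_end i (w1 ++ w2) = walk_end (walk_end i w1) w2.
Proof. by rewrite /walk_end map_cat last_cat. Qed.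

Lemma psuffix_suffix j k g :
  psuffix j (psuffix k g) = psuffix (k + j) g.
Proof.
apply: val_inj => /=.
by rewrite -walk_end_cat -takeD drop_drop [(j + k)%N]addnC.
Qed.

Lemma psuffix_prefix j k g :
  (j <= k)%N -> psuffix j (pprefix k g) = pprefix (k - j) (psuffix j g).
Proof.
by move=> jk; apply: val_inj => /=; rewrite take_takel // take_drop subnK.
Qed.

Lemma pprefix0 g : pprefix 0 g = trivial_path (psrc g).
Proof. by apply: val_inj; rewrite /= take0. Qed.

Lemma psuffix0 g : psuffix 0 g = g.
Proof. by apply: val_inj; case: g => [[i w] ?] /=; rewrite take0 drop0. Qed.

Lemma pprefix_all g : pprefix (plen g) g = g.
Proof. by apply: val_inj; case: g => [[i w] ?] /=; rewrite take_size. Qed.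

End Paths.

(* The formal power series algebra P((E)); the product is convolution over    *)
(* the factorizations of a path.                                              *)
Section Series.
Variables (K : fieldType) (E : quiver).

Record series := Series { coef : qpath E -> K }.

HB.instance Definition _ := gen_eqMixin series.
HB.instance Definition _ := gen_choiceMixin series.

Lemma seriesP (f g : series) : coef f =1 coef g -> f = g.
Proof. by case: f g => [f] [g] /= /funext->. Qed.

Definition series_zero := Series (fun=> 0).
Definition series_opp f := Series (fun g => - coef f g).
Definition series_add f1 f2 := Series (fun g => coef f1 g + coef f2 g).
Definition series_scale (a : K) f := Series (fun g => a * coef f g).
Definition series_one := Series (fun g => (plen g == 0)%:R).
Definition series_mul f1 f2 := Series (fun g =>
  \sum_(k < (plen g).+1) coef f1 (pprefix k g) * coef f2 (psuffix k g)).

Fact series_addA : associative series_add.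
Proof. by move=> f g h; apply: seriesP => x /=; rewrite addrA. Qed.
Fact series_addC : commutative series_add.
Proof. by move=> f g; apply: seriesP => x /=; rewrite addrC. Qed.
Fact series_add0 : left_id series_zero series_add.
Proof. by move=> f; apply: seriesP => x /=; rewrite add0r. Qed.
Fact series_addN : left_inverse series_zero series_opp series_add.
Proof. by move=> f; apply: seriesP => x /=; rewrite addNr. Qed.

HB.instance Definition _ := GRing.isZmodule.Build series
  series_addA series_addC series_add0 series_addN.

Fact series_scaleA a b f :
  series_scale a (series_scale b f) = series_scale (a * b) f.
Proof. by apply: seriesP => x /=; rewrite mulrA. Qed.
Fact series_scale1 : left_id 1 series_scale.
Proof. by move=> f; apply: seriesP => x /=; rewrite mul1r. Qed.
Fact series_scaleDr : right_distributive series_scale +%R.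
Proof. by move=> a f g; apply: seriesP => x /=; rewrite mulrDr. Qed.
Fact series_scaleDl f : {morph series_scale^~ f : a b / a + b}.
Proof. by move=> a b; apply: seriesP => x /=; rewrite mulrDl. Qed.

HB.instance Definition _ := GRing.Zmodule_isLmodule.Build K series
  series_scaleA series_scale1 series_scaleDr series_scaleDl.

Fact series_mulA : associative series_mul.
Proof.
move=> f g h; apply: seriesP => x /=.
under eq_bigr do rewrite mulr_sumr.
under [RHS]eq_bigr do rewrite mulr_suml.
pose F j k := coef f (pprefix j x) * (coef g (psuffix j (pprefix k x))
                * coef h (psuffix k x)).
transitivity (\sum_(j < (plen x).+1) \sum_(k < (plen x).+1 | (j <= k)%N) F j k).
  apply: eq_bigr => j _; rewrite plen_suffix.
  rewrite -(big_mkord xpredT (fun k => coef f (pprefix j x) *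
    (coef g (pprefix k (psuffix j x)) * coef h (psuffix k (psuffix j x))))).
  rewrite -(big_mkord (fun k => j <= k)%N (F j)).
  rewrite [RHS](big_cat_nat (n := j)) //=; last exact: ltnW.
  rewrite [X in _ = X + _]big_nat_cond [X in _ = X + _]big1 ?add0r; last first.
    by move=> k /andP[/andP[_ kj] jk]; move: kj; rewrite ltnNge jk.
  rewrite -[in RHS](add0n j) big_addn add0n subSn ?leq_ord // [RHS]big_mkcond.
  apply: eq_big_nat => k _; rewrite leq_addl /F psuffix_prefix ?leq_addl //.
  by rewrite addnK psuffix_suffix addnC.
rewrite (exchange_big_dep xpredT) //=; apply: eq_bigr => k _.
rewrite plen_prefix ?leq_ord //.
rewrite -(big_mkord xpredT (fun j => coef f (pprefix j (pprefix k x)) *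
  coef g (psuffix j (pprefix k x)) * coef h (psuffix k x))).
rewrite -(big_mkord (fun j => j <= k)%N (fun j => F j k)).
rewrite (big_cat_nat (n := k.+1)) //=.
rewrite [X in _ + X]big_nat_cond [X in _ + X]big1 ?addr0; last first.
  by move=> j /andP[/andP[kj _] jk]; move: kj; rewrite ltnNge jk.
rewrite big_nat_cond [RHS]big_nat; apply: eq_big => j; first by rewrite ltnS andbb.
by move=> /andP[_ jk]; rewrite /F pprefix_prefix // mulrA.
Qed.

Fact series_mul1l : left_id series_one series_mul.
Proof.
move=> f; apply: seriesP => x /=.
rewrite big_ord_recl pprefix0 psuffix0 mul1r big1 ?addr0 // => k _.
by rewrite lift0 plen_prefix ?mul0r.
Qed.

Fact series_mul1r : right_id series_one series_mul.
Proof.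
move=> f; apply: seriesP => x /=.
rewrite big_ord_recr /= pprefix_all plen_suffix subnn mulr1 big1 ?add0r // => k _.
by rewrite plen_suffix subn_eq0 leqNgt ltn_ord mulr0.
Qed.

Fact series_mulDl : left_distributive series_mul +%R.
Proof.
move=> f g h; apply: seriesP => x /=; rewrite -big_split.
by apply: eq_bigr => k _; rewrite mulrDl.
Qed.

Fact series_mulDr : right_distributive series_mul +%R.
Proof.
move=> f g h; apply: seriesP => x /=; rewrite -big_split.
by apply: eq_bigr => k _; rewrite mulrDr.
Qed.

HB.instance Definition _ := GRing.Zmodule_isPzRing.Build series
  series_mulA series_mul1l series_mul1r series_mulDl series_mulDr.

Lemma series_scalerAl (a : K) (f g : series) : a *: (f * g) = (a *: f) * g.
Proof.
apply: seriesP => x /=; rewrite mulr_sumr.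
by apply: eq_bigr => k _; rewrite mulrA.
Qed.

Lemma series_scalerAr (a : K) (f g : series) : a *: (f * g) = f * (a *: g).
Proof.
apply: seriesP => x /=; rewrite mulr_sumr.
by apply: eq_bigr => k _; rewrite mulrCA.
Qed.

Definition path_series (g : qpath E) : series := Series (fun h => (h == g)%:R).

(* P(E), as a subset of P((E)): the series with finite support. *)
Definition path_algebra : {pred series} := fun f =>
  `[< exists s : seq (qpath E), forall g, g \notin s -> coef f g = 0 >].

Lemma path_series_path_algebra g : path_series g \in path_algebra.
Proof.
by apply/asboolP; exists [:: g] => h; rewrite inE /= => /negPf->.
Qed.

Definition ltransduction (e : arrow E) (f : series) : series :=
  Series (fun a =>
    if prng a == src e then coef f (pcat a (arrow_path e)) else 0).

Definition rtransduction (e : arrow E) (f : series) : series :=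
  Series (fun a =>
    if psrc a == rng e then coef f (pcat (arrow_path e) a) else 0).

Lemma ltransduction_linear e : linear (ltransduction e).
Proof.
by move=> a f g; apply: seriesP => x /=; case: eqP => //; rewrite mulr0 addr0.
Qed.

(* The library's subalgClosed assumes 1 != 0, which fails if E has no vertex. *)
Definition subalgebra (R : {pred series}) : Prop :=
  GRing.subring_closed R /\ GRing.scaler_closed R.

Definition invertible_in (R : {pred series}) (f : series) : Prop :=
  exists2 g, g \in R & f * g = 1 /\ g * f = 1.

Definition inversion_closed (R : {pred series}) : Prop :=
  forall f, f \in R -> invertible_in predT f -> invertible_in R f.

End Series.

(* R as a type; the proof is a parameter so that the ring and module          *)
(* structures can be inferred from the type alone.                            *)
Definition subalg (K : fieldType) (E : quiver) (R : {pred series K E})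
  of subalgebra R : Type := {f : series K E | f \in R}.

Section SubalgebraType.
Variables (K : fieldType) (E : quiver) (R : {pred series K E}).
Hypothesis R_alg : subalgebra R.

Fact subalgebra_submod : GRing.subsemimod_closed R.
Proof.
have [[R1 RB _] RZ] := R_alg.
have R0 : 0 \in R by rewrite -(subrr 1) RB.
split=> //; split=> // f g fR gR.
by rewrite -[g]opprK RB // -[- g]sub0r RB.
Qed.

HB.instance Definition _ := SubChoice.on (subalg R_alg).
HB.instance Definition _ :=
  GRing.SubChoice_isSubPzRing.Build (series K E) (mem R) (subalg R_alg)
    R_alg.1.
HB.instance Definition _ :=
  GRing.SubZmodule_isSubLmodule.Build K (series K E) (mem R) (subalg R_alg)
    subalgebra_submod.

Lemma subalg_scalerAl (a : K) (f g : subalg R_alg) : a *: f * g = a *: (f * g).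
Proof. by apply: val_inj; rewrite /= -series_scalerAl. Qed.

End SubalgebraType.

(* S_ring is R<\bar E; tau, delta>, the subring of End_K(R) generated by the  *)
(* right multiplications and the left transductions. The maps tau_e do not    *)
(* enter its definition, only the resulting commutation rule                  *)
(*   r \bar e = \bar e (r tau_e) + (r delta_e).                               *)
(* S_of r and S_bar e are the elements r and \bar e of S.                     *)
Section TransductionRing.
Variables (K : fieldType) (E : quiver) (R : {pred series K E}).
Hypothesis R_alg : subalgebra R.
Hypothesis R_path : {subset @path_algebra K E <= R}.
Hypothesis R_ltr : forall e, {homo ltransduction e : f / f \in R}.

Local Notation RT := (subalg R_alg).

Fact rmult_linear (r : RT) : linear (fun x : RT => x * r).
Proof. by move=> a x y; rewrite mulrDl subalg_scalerAl. Qed.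

Definition rmult (r : RT) : endo RT := Endo (rmult_linear r).

Definition ltr_subalg (e : arrow E) (f : RT) : RT :=
  exist _ (ltransduction e (val f)) (R_ltr e (valP f)).

Fact ltr_subalg_linear e : linear (ltr_subalg e).
Proof. by move=> a x y; apply: val_inj; rewrite /= ltransduction_linear. Qed.

Definition ltr_endo (e : arrow E) : endo RT := Endo (ltr_subalg_linear e).

Definition S_generator (u : endo RT) : Prop :=
  (exists r : RT, u = rmult r) \/ (exists e : arrow E, u = ltr_endo e).

Definition S_ring := gen_subring_of S_generator.
HB.instance Definition _ := GRing.PzRing.on S_ring.

Definition S_of (r : RT) : S_ring :=
  GenSubring (mem_gen_subring (or_introl (ex_intro _ r erefl))).

Definition S_bar (e : arrow E) : S_ring :=
  GenSubring (mem_gen_subring (or_intror (ex_intro _ e erefl))).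

Definition S_path (g : qpath E) : S_ring :=
  S_of (exist _ (path_series K g) (R_path (path_series_path_algebra K g))).

Definition S_q_vertex (i : vertex E) : S_ring :=
  S_path (trivial_path i)
    - \sum_(e : arrow E | rng e == i) S_bar e * S_path (arrow_path e).

Definition S_q : S_ring :=
  \sum_(i : vertex E | [exists e : arrow E, rng e == i]) S_q_vertex i.

Definition T_ring := quotient_ring (principal_ideal S_q).
HB.instance Definition _ := GRing.PzRing.on T_ring.

End TransductionRing.

(* Main.v *)
Require Import Defs.
From mathcomp Require Import all_boot all_order all_algebra.
From mathcomp Require Import boolp.

(** T is a quotient of S, so it suffices that S is von Neumann regular, that is,
    that every principal left ideal S a contains a right unit for a.

    S acts on R, and q_i is the projection x |-> x_0(i) p_i on the constant
    term at the vertex i. Splitting the last arrow off a series gives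
    1 = sum_i q_i + sum_e \bar e e; iterated, this gives the identity of
    [expansion],
      1 = sum_(|gamma| = n) \bar gamma gamma
          + sum_(|gamma| < n) sum_i \bar gamma q_i gamma.
    For a in S and n large, every r of order at least n satisfies r a \in R
    ([shifts_ex]). So the rows gamma a with |gamma| = n lie in R, and they are
    treated by Gaussian elimination ([gauss_elimination]). The pivot is a row
    p_i r of least order. It has a path gamma of that length in its support,
    and stripping gamma from the right turns it into a series of p_i R with a
    nonzero constant term at i, which closure under inversion makes invertible
    ([R_pivots]); the minimality of gamma keeps all the other rows in R. The
    result is y with gamma a y a = gamma a for all gamma of length n.

    The difference b = a - a y a then kills all the gamma of length n, so by the
    expansion of 1 it is determined by the finitely many rank one rows
    q_i gamma b with |gamma| < n. The same elimination, where now any nonzero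
    coefficient is a pivot ([q_pivots]), gives z with b z b = b. Since b is
    a - a y a, McCoy's lemma ([regular_mod]) makes a regular. *)

Set Implicit Arguments.
Unset Strict Implicit.
Unset Printing Implicit Defensive.

Import GRing.Theory.
Local Open Scope ring_scope.
Local Open Scope quotient_scope.

(** * Regular elements and elimination *)

Section RegularElements.
Variable A : pzRingType.
Implicit Types a x y z : A.

Definition regular a := exists b, a * b * a = a.

(** McCoy: regularity may be tested modulo a S a. *)
Lemma regular_mod a x : regular (a - a * x * a) -> regular a.
Proof.
case=> y ay; exists (x + (1 - x * a) * y * (1 - a * x)).
rewrite mulrDr mulrDl.
have -> : a * ((1 - x * a) * y * (1 - a * x)) * a =
    (a - a * x * a) * y * (a - a * x * a).
  by rewrite !mulrBl !mulrBr !mulrBl !mulr1 !mul1r !mulrA.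
by rewrite ay addrC subrK.
Qed.

(** If x = x z x, then y - y z x is the row y after elimination of its entry
    below the pivot x. The whole list is given to the choice of the pivot,
    since a pivot of minimal order will be needed. *)
Definition has_pivots (C : A -> Prop) := forall l : seq A,
  {in l, forall x, C x} -> (exists2 x, x \in l & x <> 0) ->
  exists2 x, x \in l & exists2 z,
    x * (z * x) = x & {in l, forall y, C (y - y * (z * x))}.

(** Elimination of one row at a time exhausts the list: if g is a right unit
    for the rows y - y h left over, then h + (1 - h) g is one for the rows y.
    Since h lies in A a whenever the pivot does, so does the right unit. *)
Lemma gauss_elimination (C : A -> Prop) a (l : seq A) : has_pivots C ->
  {in l, forall x, C x /\ exists y, x = y * a} ->
  exists y, {in l, forall x, x * (y * a) = x}.
Proof.
move=> piv; have [n] := ubnP (size l); elim: n l => // n IH l szl Cl.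
have [[t tl t0]|l0] := pselect (exists2 x, x \in l & x <> 0); last first.
  exists 0 => x xl; rewrite mul0r mulr0; apply: contrapT => x0.
  by apply: l0; exists x => // /esym.
have [x xl [z xz Cz]] : exists2 x, x \in l & exists2 z,
    x * (z * x) = x & {in l, forall y, C (y - y * (z * x))}.
  by apply: piv => [y /Cl[]|]; last exists t.
have [_ [c xc]] := Cl x xl.
pose l' := [seq y - y * (z * x) | y <- rem x l].
have [||g gl'] := IH l'.
- by rewrite size_map size_rem //; case: (l) xl szl.
- move=> _ /mapP[y /mem_rem yl ->]; split; first exact: Cz.
  have [_ [d ->]] := Cl y yl; exists (d - d * a * z * c).
  by rewrite mulrBl {1}xc !mulrA.
have xza : z * x = z * c * a by rewrite {1}xc mulrA.
exists (z * c + g - z * c * a * g) => y.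
rewrite mulrBl mulrDl -xza -[z * x * g * a]mulrA mulrBr mulrDr.
rewrite [y * (z * x * _)]mulrA.
rewrite -addrA -mulrBl (perm_mem (perm_to_rem xl)) inE => /predU1P[->|yl].
  by rewrite xz subrr mul0r addr0.
by rewrite gl'; [rewrite addrC subrK | apply/mapP; exists y].
Qed.

End RegularElements.

(** * Order of a series and invertibility *)

Section SeriesOrder.
Variables (K : fieldType) (E : quiver).
Implicit Types f g : series K E.

Definition ord_ge n f := forall x, (plen x < n)%N -> coef f x = 0.

Lemma ord_ge0 f : ord_ge 0 f.
Proof. by []. Qed.

Lemma ord_ge_le n m f : (n <= m)%N -> ord_ge m f -> ord_ge n f.
Proof. by move=> nm fm g gn; apply: fm; apply: leq_trans nm. Qed.

Lemma ord_geB n f g : ord_ge n f -> ord_ge n g -> ord_ge n (f - g).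
Proof. by move=> fn gn x xn /=; rewrite fn // gn // subr0. Qed.

Lemma ord_geM n m f g : ord_ge n f -> ord_ge m g -> ord_ge (n + m) (f * g).
Proof.
move=> fn gm x xnm /=; apply: big1 => k _.
have [kn|nk] := ltnP k n; first by rewrite fn ?mul0r // plen_prefix // -ltnS.
rewrite [coef g _]gm ?mulr0 // plen_suffix.
rewrite ltn_subLR; last by rewrite -ltnS.
by rewrite (leq_trans xnm) // leq_add2r.
Qed.

Lemma ord_geX n f : ord_ge 1 f -> ord_ge n (f ^+ n).
Proof.
move=> f1; elim: n => [|n IH]; first exact: ord_ge0.
by rewrite exprS -add1n; apply: ord_geM.
Qed.

Lemma coef_sum I (r : seq I) (F : I -> series K E) x :
  coef (\sum_(i <- r) F i) x = \sum_(i <- r) coef (F i) x.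
Proof. by elim: r => [|i r IH]; rewrite ?big_nil // !big_cons -IH. Qed.

Lemma coef_local f f' g g' x :
  (forall y, (plen y <= plen x)%N -> coef f y = coef f' y) ->
  (forall y, (plen y <= plen x)%N -> coef g y = coef g' y) ->
  coef (f * g) x = coef (f' * g') x.
Proof.
move=> ff gg /=; apply: eq_bigr => k _; rewrite ff ?gg //.
  by rewrite plen_suffix leq_subr.
by rewrite plen_prefix // -ltnS.
Qed.

(** Geometric series: the coefficient at x of the infinite sum of the powers
    of m is that of any partial sum with more terms than the length of x. *)
Lemma invertible_1B m : ord_ge 1 m -> invertible_in predT (1 - m).
Proof.
move=> m1; pose G n := \sum_(k < n) m ^+ k.
pose g := Series (fun x => coef (G (plen x).+1) x).
have gG x y : (plen y <= plen x)%N -> coef g y = coef (G (plen x).+1) y.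
  move=> yx; rewrite /= /G !coef_sum.
  rewrite -(big_mkord xpredT (fun k => coef (m ^+ k) y)).
  rewrite -(big_mkord xpredT (fun k => coef (m ^+ k) y)).
  rewrite [RHS](big_cat_nat (n := (plen y).+1)) //=.
  rewrite [X in _ = _ + X]big1_seq ?addr0 // => k /andP[_].
  by rewrite mem_index_iota => /andP[yk _]; apply: (@ord_geX k m m1).
have cm n : m * G n = G n * m.
  rewrite mulr_sumr mulr_suml; apply: eq_bigr => k _.
  by rewrite -exprS -exprSr.
have tele n : (1 - m) * G n = 1 - m ^+ n.
  elim: n => [|n IH]; first by rewrite /G big_ord0 mulr0 expr0 subrr.
  rewrite /G big_ord_recr /= mulrDr IH mulrBl mul1r -exprS.
  by rewrite addrA subrK.
exists g => //; split; apply: seriesP => x.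
  rewrite (@coef_local _ (1 - m) _ (G (plen x).+1)) //; last exact: gG.
  by rewrite tele /= [coef (m ^+ _) x]ord_geX // subr0.
rewrite (@coef_local _ (G (plen x).+1) _ (1 - m)) //; last exact: gG.
rewrite mulrBr mulr1 -cm -[X in X - _]mul1r -mulrBl tele /=.
by rewrite [coef (m ^+ _) x]ord_geX // subr0.
Qed.

Lemma ord_ge1P f : (forall i, coef f (trivial_path i) = 0) -> ord_ge 1 f.
Proof.
move=> f0 [[i w] iw]; rewrite /plen ltnS leqn0 /= => /nilP w0.
by rewrite -(f0 i); congr coef; apply: val_inj; rewrite /= w0.
Qed.

(** * Products with vertices and arrows, and transductions *)

Lemma coef_idem_mul i f x :
  coef (path_series K (trivial_path i) * f) x = (psrc x == i)%:R * coef f x.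
Proof.
rewrite /= big_ord_recl big1 ?addr0 => [|k _]; last first.
  case: eqP => [/(congr1 (@plen E))|]; last by rewrite mul0r.
  by rewrite lift0 plen_prefix.
rewrite pprefix0 psuffix0 -val_eqE /=.
by rewrite xpair_eqE /= andbT.
Qed.

Lemma coef_mul_idem f i (g : qpath E) :
  coef (f * path_series K (trivial_path i)) g = (prng g == i)%:R * coef f g.
Proof.
rewrite /= big_ord_recr /= big1 ?add0r => [|k _]; last first.
  case: eqP => [/(congr1 (@plen E))|]; last by rewrite mulr0.
  by rewrite plen_suffix /= => /eqP; rewrite subn_eq0 leqNgt ltn_ord.
rewrite pprefix_all mulrC; congr (_%:R * _); rewrite -val_eqE /=.
by rewrite drop_size take_size xpair_eqE /= andbT.
Qed.

Lemma coef_mul_arrow0 f e i :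
  coef (f * path_series K (arrow_path e)) (trivial_path i) = 0.
Proof. by rewrite /= big_ord1 -val_eqE /= xpair_eqE andbF mulr0. Qed.

Lemma coef_mul_arrow f e e' (a g : qpath E) : val g = (a.1, rcons a.2 e') ->
  coef (f * path_series K (arrow_path e)) g = (e' == e)%:R * coef f a.
Proof.
move=> ga; have sg : plen g = (plen a).+1 by rewrite /plen ga size_rcons.
rewrite /= sg 2!big_ord_recr /= big1 ?add0r => [|k _]; last first.
  case: eqP => [/(congr1 (@plen E))|]; last by rewrite mulr0.
  rewrite plen_suffix sg /= => /eqP.
  by rewrite subSn 1?ltnW // eqSS subn_eq0 leqNgt ltn_ord.
rewrite [X in _ + X](_ : _ = 0) ?addr0; last first.
  case: eqP => [/(congr1 (@plen E))|]; last by rewrite mulr0.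
  by rewrite plen_suffix sg subnn.
rewrite mulrC; congr (_%:R * coef f _); last first.
  by apply: val_inj; rewrite /= ga -cats1 takel_cat ?take_size //; case: (val a).
have := walk_ofP g; rewrite -val_eqE /= ga -cats1 /= is_walk_cat /=.
move=> /and3P[_ /eqP src_e' _]; rewrite drop_cat ltnn subnn drop0 takel_cat // take_size -src_e'.
rewrite xpair_eqE eqseq_cons andbT.
by have [->|] := eqVneq e' e; rewrite ?eqxx ?andbF.
Qed.

Lemma val_pcat (g : qpath E) e : prng g = src e ->
  val (pcat g (arrow_path e)) = (g.1, g.2 ++ [:: e]).
Proof.
move=> ge; rewrite /pcat val_insubd /= is_walk_cat (walk_ofP g) /=.
by rewrite andbT eq_sym -/(prng g) ge eqxx.
Qed.

Lemma coef_ltransduction e f x :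
  coef (ltransduction e f) x =
    if prng x == src e then coef f (pcat x (arrow_path e)) else 0.
Proof. by []. Qed.

Lemma ltransduction_idem_mul i e f :
  ltransduction e (path_series K (trivial_path i) * f) =
  path_series K (trivial_path i) * ltransduction e f.
Proof.
apply: seriesP => x; rewrite coef_idem_mul !coef_ltransduction.
case: eqP => [xe|_]; last by rewrite mulr0.
by rewrite coef_idem_mul /psrc val_pcat.
Qed.

Lemma ord_ge_ltransduction e k f :
  ord_ge k.+1 f -> ord_ge k (ltransduction e f).
Proof.
move=> fk x xk /=; case: eqP => // xe; apply: fk.
by rewrite /plen val_pcat // size_cat addn1 ltnS.
Qed.

(** The skew term of the commutation rule carries the constant term of f,
    hence disappears here. *)
Lemma ltransduction_mul_ord e (h : series K E) f : ord_ge 1 f ->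
  ltransduction e (h * f) = h * ltransduction e f.
Proof.
move=> f1; apply: seriesP => g /=.
case: eqP => ge; last first.
  rewrite big1 // => k _; case: eqP => [ke|]; last by rewrite mulr0.
  case: ge; rewrite -ke /prng /psuffix /= -walk_end_cat cat_take_drop.
  by [].
rewrite /plen val_pcat // size_cat addn1 big_ord_recr /= [X in _ + X]mulrC.
rewrite [coef f (psuffix _ _)]f1 ?mul0r ?addr0; last first.
  by rewrite plen_suffix /plen val_pcat // size_cat addn1 subnn.
apply: eq_bigr => k _.
have pse : prng (psuffix k g) = src e.
  by rewrite -ge /prng /= -walk_end_cat cat_take_drop.
have kg : (k <= size g.2)%N by rewrite -ltnS.
rewrite pse eqxx; congr (coef h _ * coef f _); apply: val_inj => /=.
  by rewrite val_pcat //= takel_cat.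
rewrite [RHS](val_pcat pse) /= val_pcat //= takel_cat // drop_cat.
case: ltnP => // gk; have -> : nat_of_ord k = size g.2.
  by apply/eqP; rewrite eqn_leq kg.
by rewrite subnn drop0 drop_size.
Qed.

End SeriesOrder.

(** * The ring of transductions acting on R *)

Section TransductionRingTheory.
Variables (K : fieldType) (E : quiver) (R : {pred series K E}).
Hypothesis R_alg : subalgebra R.
Hypothesis R_path : {subset @path_algebra K E <= R}.
Hypothesis R_ltr : forall e, {homo ltransduction e : f / f \in R}.

Local Notation RT := (subalg R_alg).
Local Notation S := (S_ring R_alg R_ltr).
Local Notation mulS := (S_of R_ltr).
Local Notation bar := (S_bar R_alg R_ltr).

Implicit Types (r : RT) (s t : S) (w : seq (arrow E)).

Definition act (s : S) : RT -> RT := endo_fun (val s).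

Lemma actP (s t : S) : (forall x, val (act s x) = val (act t x)) -> s = t.
Proof.
by move=> st; apply: val_inj; apply: endoP => x; apply: val_inj; apply: st.
Qed.

Lemma actD s x y : act s (x + y) = act s x + act s y.
Proof. exact: endoD. Qed.

Lemma actZ s c x : act s (c *: x) = c *: act s x.
Proof.
have act0 : act s 0 = 0 by apply: (addrI (act s 0)); rewrite -actD !addr0.
by have := endo_linear (val s) c x 0; rewrite !addr0 -/(act s 0) act0 addr0.
Qed.

Lemma act_sub s t x : act (s - t) x = act s x - act t x.
Proof. by []. Qed.

Lemma act_mul s t x : act (s * t) x = act t (act s x).
Proof. by []. Qed.

Lemma act_sum I (l : seq I) (P : pred I) (F : I -> S) x :
  act (\sum_(i <- l | P i) F i) x = \sum_(i <- l | P i) act (F i) x.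
Proof.
elim: l => [|i l IH]; first by rewrite !big_nil.
by rewrite !big_cons; case: ifP => // _; rewrite -IH.
Qed.

Lemma val_sub r r' : val (r - r') = val r - val r'.
Proof. by []. Qed.

Lemma val_sum I (l : seq I) (P : pred I) (F : I -> RT) :
  val (\sum_(i <- l | P i) F i) = \sum_(i <- l | P i) val (F i).
Proof. exact: raddf_sum. Qed.

Lemma S_of_mul r r' : mulS (r * r') = mulS r * mulS r'.
Proof. by apply: actP => x /=; rewrite mulrA. Qed.

Lemma S_of_sub r r' : mulS (r - r') = mulS r - mulS r'.
Proof. by apply: actP => x /=; rewrite mulrBr. Qed.

Lemma act_S_of r x : act (mulS r) x = x * r.
Proof. by []. Qed.

Lemma act_scalar c x : act (mulS (c *: (1 : RT))) x = c *: x.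
Proof. by apply: val_inj; rewrite /= -series_scalerAr mulr1. Qed.

Lemma S_ind (P : endo RT -> Prop) :
  P 1 -> (forall f g, P f -> P g -> P (f - g)) ->
  (forall f g, P f -> P g -> P (f * g)) ->
  (forall r, P (rmult r)) -> (forall e, P (ltr_endo R_alg R_ltr e)) ->
  forall s : S, P (val s).
Proof.
move=> P1 PB PM Pr Pe s.
have /gen_subringP /(_ (fun f => `[< P f >])) := gen_valP s.
move=> H; apply/asboolP; apply: H.
  split; first exact/asboolP.
    by move=> f g /asboolP Pf /asboolP Pg; apply/asboolP/PB.
  by move=> f g /asboolP Pf /asboolP Pg; apply/asboolP/PM.
by move=> _ [[r ->]|[e ->]]; apply/asboolP.
Qed.

Definition idem i : RT :=
  exist _ (path_series K (trivial_path i))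
    (R_path (path_series_path_algebra K (trivial_path i))).

Definition arr e : RT :=
  exist _ (path_series K (arrow_path e))
    (R_path (path_series_path_algebra K (arrow_path e))).

(** Elements of S act on the right, so that left multiplication by p_i
    commutes with them: each p_i R is stable under S. *)
Lemma act_idem (s : S) i x : act s (idem i * x) = idem i * act s x.
Proof.
rewrite /act.
apply: (S_ind (P := fun f => forall x, f (idem i * x) = idem i * f x)).
- by [].
- by move=> f g /= fi gi y; rewrite fi gi mulrBr.
- by move=> f g /= fi gi y; rewrite fi gi.
- by move=> r y /=; rewrite mulrA.
- by move=> e y; apply: val_inj; rewrite /= ltransduction_idem_mul.
Qed.

(** * Operators on series of large order *)

(** By iteration of r \bar e = \bar e (r tau_e) + (r delta_e), an element of S
    is a finite sum of terms \bar gamma r_gamma with gamma of length at most n.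
    When r has order at least n, only transduced terms survive in r times such
    a sum, so the product is again a right multiplication, and at most n is
    lost on the order. Asking this for every k makes the notion stable under
    products without writing down the normal form. *)
Definition shifts n (f : endo RT) := forall k r, ord_ge (n + k) (val r) ->
  rmult r * f = rmult (f r) /\ ord_ge k (val (f r)).

Lemma shifts_le n m f : (n <= m)%N -> shifts n f -> shifts m f.
Proof.
move=> nm fn k r rk.
have [|-> frk] := fn (m - n + k)%N r; first by rewrite addnA subnKC.
by split=> //; apply: ord_ge_le frk; rewrite leq_addl.
Qed.

Lemma shiftsM n m f g : shifts n f -> shifts m g -> shifts (n + m) (f * g).
Proof.
move=> fn gm k r; rewrite -addnA => /fn[rf /gm[rg ok]]; split=> //.
by rewrite mulrA rf rg.
Qed.

Lemma shifts_rmult r : shifts 0 (rmult r).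
Proof.
move=> k r' r'k; split; first by apply: endoP => x /=; rewrite mulrA.
by move: (@ord_geM K E k 0 _ (val r) r'k); rewrite addn0; apply.
Qed.

Lemma shifts_ltr e : shifts 1 (ltr_endo R_alg R_ltr e).
Proof.
move=> k r rk; split; last exact: ord_ge_ltransduction.
apply: endoP => x; apply: val_inj; rewrite /= ltransduction_mul_ord //.
exact: ord_ge_le rk.
Qed.

Lemma shifts_ex (s : S) : exists n, shifts n (val s).
Proof.
apply: (S_ind (P := fun f => exists n, shifts n f)).
- by exists 0%N => k r rk; rewrite mulr1.
- move=> f g [n fn] [m gm]; exists (maxn n m) => k r rk.
  have [rf fk] := shifts_le (leq_maxl n m) fn rk.
  have [rg gk] := shifts_le (leq_maxr n m) gm rk.
  split; last exact: ord_geB.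
  by rewrite mulrBr rf rg; apply: endoP => x /=; rewrite mulrBr.
- by move=> f g [n fn] [m gm]; exists (n + m)%N; apply: shiftsM.
- by move=> r; exists 0%N; apply: shifts_rmult.
- by move=> e; exists 1%N; apply: shifts_ltr.
Qed.

(** * Resolutions of the identity *)

(** Transductions strip arrows from the right end, so the last arrow of the
    word has to act first. *)
Fixpoint bars (w : seq (arrow E)) : S :=
  if w is e :: w' then bars w' * bar e else 1.

Lemma shifts_bars w : shifts (size w) (val (bars w)).
Proof.
elim: w => [|e w IH] /=; first by move=> k r rk; rewrite mulr1.
by rewrite -addn1; apply: shiftsM (shifts_ltr e).
Qed.

(** Only trivial paths a are needed in the end; a grows in the induction, as the
    arrow stripped last is the first of the word. *)
Lemma coef_bars w x (a g : qpath E) : val g = (a.1, a.2 ++ w) ->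
  coef (val (act (bars w) x)) a = coef (val x) g.
Proof.
elim: w a => [|e w IH] a ga /=.
  by congr coef; apply: val_inj; rewrite ga cats0 -surjective_pairing.
have ae : prng a = src e.
  have := walk_ofP g; rewrite ga /= is_walk_cat /= => /andP[_ /andP[/eqP-> _]].
  by [].
by rewrite ae eqxx; apply: IH; rewrite val_pcat //= -catA.
Qed.

Local Notation q := (S_q_vertex R_alg R_path R_ltr).

(** The defining sum of q_i takes away from x p_i everything that ends in an
    arrow, so q_i has rank one; at a source the sum is empty and q_i = p_i. *)
Lemma act_q i x :
  act (q i) x = coef (val x) (trivial_path i) *: idem i.
Proof.
apply: val_inj; apply: seriesP => g; rewrite act_sub act_sum.
rewrite val_sub val_sum.
rewrite -[coef (_ - _) g]/(coef _ g - coef _ g).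
rewrite big_mkcond coef_sum [val (act _ _)]/= coef_mul_idem.
have [a|[e [a ga]]] : (exists j, g = trivial_path j) \/
    exists e, exists a : qpath E, val g = (a.1, rcons a.2 e).
  case: g => [[j w]]; case/lastP: w => [|w e] jw.
    by left; exists j; apply: val_inj.
  right; exists e; have jw' : is_walk j w.
    by move: jw; rewrite /= -cats1 is_walk_cat => /andP[].
  by exists (@QPath _ (j, w) jw').
- case: a => j ->; rewrite big1 ?subr0 => [|e _]; last first.
    by case: ifP => // _; rewrite coef_mul_arrow0.
  rewrite /= mulrC -val_eqE /= xpair_eqE /= andbT.
  by rewrite /prng /walk_end /=; case: eqP => [->//|]; rewrite !mulr0.
have ng : (g == trivial_path i) = false.
  by rewrite -val_eqE /= ga xpair_eqE /=; case: (a.2) => [|? ?]; rewrite andbF.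
rewrite /= ng mulr0.
have src_e : prng a = src e.
  have := walk_ofP g; rewrite ga /= -cats1 is_walk_cat /= => /and3P[_ /eqP-> _].
  by [].
have ge : prng g = rng e.
  by rewrite /prng /walk_end ga /= map_rcons last_rcons.
rewrite (bigD1 e) //= big1 ?addr0 => [|e' e'e]; last first.
  case: ifP => // _; rewrite -/(coef (_ * _) _) (coef_mul_arrow _ _ ga).
  by rewrite eq_sym (negPf e'e) mul0r.
rewrite ge; case: eqP => _; last by rewrite mul0r subr0.
rewrite -/(coef (_ * _) _) (coef_mul_arrow _ _ ga) eqxx /= src_e eqxx.
suff -> : pcat a (arrow_path e) = g by rewrite subrr.
by apply: val_inj; rewrite val_pcat // ga cats1.
Qed.

Lemma sum_idem : \sum_i mulS (idem i) = 1.
Proof.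
apply: actP => x; rewrite act_sum val_sum; apply: seriesP => g.
rewrite coef_sum (bigD1 (prng g)) // big1 => [|i gi].
  by rewrite [LHS]addr0 [val (act _ _)]/= coef_mul_idem eqxx mul1r.
by rewrite [val (act _ _)]/= coef_mul_idem eq_sym (negPf gi) mul0r.
Qed.

(** This is the relation x = x_0 + sum_e (x delta_e) e between a series, its
    constant part and its transductions. *)
Lemma one_expand : 1 = \sum_i q i + \sum_e bar e * mulS (arr e).
Proof.
rewrite sumrB -[X in X - _]/(\sum_i mulS (idem i)) sum_idem.
by rewrite [X in _ + X](partition_big (@rng E) xpredT) //= subrK.
Qed.

(** The word need not be a walk: the product is 0 if it is not. *)
Fixpoint fwd (w : seq (arrow E)) : RT :=
  if w is e :: w' then arr e * fwd w' else 1.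

Lemma ord_ge_fwd w : ord_ge (size w) (val (fwd w)).
Proof.
elim: w => [|e w IH] /=; first exact: ord_ge0.
rewrite -add1n; apply: ord_geM => // g g0 /=; case: eqP => // ge.
by rewrite ge in g0.
Qed.

(** Iteration of one_expand inside the terms of full length; the words of u are
    the shorter ones, whose terms together split off the part of order less
    than n. *)
Lemma expansion n : exists l u : seq (seq (arrow E)),
  all (fun w => size w == n) l /\
  1 = \sum_(w <- l) bars w * mulS (fwd w) +
      \sum_(w <- u) \sum_i bars w * q i * mulS (fwd w).
Proof.
elim: n => [|n [l [u [ln ex]]]].
  exists [:: [::]], [::]; split=> //; rewrite big_seq1 big_nil addr0 mul1r.
  by apply: actP => x /=; rewrite mulr1.
exists [seq e :: w | w <- l, e <- enum (arrow E)], (l ++ u); split.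
  by apply/allP=> _ /allpairsP[[w e] /= [/(allP ln)/eqP<- _ ->]].
rewrite {1}ex big_cat addrA; congr (_ + _).
rewrite big_allpairs_dep -big_split; apply: eq_bigr => w _ /=.
rewrite -[X in X * mulS _]mulr1 one_expand mulrDr mulrDl addrC.
rewrite !mulr_sumr !mulr_suml big_enum /=; congr (_ + _).
by apply: eq_bigr => e _; rewrite S_of_mul !mulrA.
Qed.

Lemma idem_idem i : idem i * idem i = idem i.
Proof.
apply: val_inj; apply: seriesP => g; rewrite [val _]/= coef_idem_mul /=.
rewrite -val_eqE; case: g => [[j w] jw] /=; rewrite /psrc /= xpair_eqE.
by case: eqP => //= _; rewrite ?mul1r ?mul0r.
Qed.

Lemma idem_supp i x (g : qpath E) :
  idem i * x = x -> coef (val x) g <> 0 -> psrc g = i.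
Proof.
move=> ix; rewrite -ix [val _]/= coef_idem_mul.
by case: eqP => // _; rewrite mul0r.
Qed.

Lemma act_neq0 (s : S) x :
  act s x <> 0 -> exists g, coef (val (act s x)) g != 0.
Proof.
move=> sx; apply: contrapT => /forallNP s0; apply: sx; apply: val_inj.
by apply: seriesP => g; apply/eqP/negPn/negP; apply: s0.
Qed.

(** * Pivots and regularity of S *)

(** Rows of rank one: if q_i x = x, then x sends y to the constant term of y at
    i times v = p_i x. A path in the support of v is stripped to recover the
    pivot, so here any nonzero row may serve as pivot. *)
Lemma q_pivots : has_pivots (fun s : S => exists i, q i * s = s).
Proof.
move=> l lq [x xl x0]; exists x => //; have [i qx] := lq x xl.
pose v := act x (idem i).
have xv (t : RT) : act x t = coef (val t) (trivial_path i) *: v.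
  by rewrite -qx act_mul act_q actZ.
have iv : idem i * v = v by rewrite -act_idem idem_idem.
have [g vg] : exists g, coef (val v) g != 0.
  apply: act_neq0 => v0; apply: x0; apply: actP => t.
  by rewrite xv /v v0 scaler0.
exists (bars g.2 * mulS ((coef (val v) g)^-1 *: (1 : RT))).
  apply: actP => t; congr val; rewrite !act_mul act_scalar [act x t]xv !actZ.
  rewrite [X in _ *: (_ *: X)]xv (@coef_bars _ _ _ g).
    by rewrite !scalerA mulrAC mulVf // mul1r.
  rewrite -(idem_supp iv (g := g)); last exact/eqP.
  by rewrite /psrc /= -surjective_pairing.
by move=> y /lq[j qy]; exists j; rewrite mulrBr qy mulrA qy.
Qed.

Hypothesis R_inv : inversion_closed R.

(** Rows in R: if a row p_i r of minimal order n has the path gamma of length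
    n in its support, then all rows remain in R after stripping gamma, and
    p_i r becomes an element u of p_i R with nonzero constant term at i. Up to a
    scalar, u is p_i times a series all of whose constant terms are 1, and
    closure under inversion gives the inverse within R. Minimality is essential:
    stripped of gamma, a row of smaller order could leave R. *)
Lemma R_pivots : has_pivots (fun s : S =>
  s = mulS (act s 1) /\ exists i, mulS (idem i) * s = s).
Proof.
move=> l lC [x1 x1l x10].
(* The length of gamma is minimal over the supports of all the rows. *)
pose P n := `[< exists2 x, x \in l &
  exists2 g, plen g = n & coef (val (act x 1)) g <> 0 >].
have Pex : exists n, P n.
  have [g /eqP x1g] : exists g, coef (val (act x1 1)) g != 0.
    apply: act_neq0 => a0; apply: x10; have [-> _] := lC _ x1l.
    by rewrite a0; apply: actP => t /=; rewrite mulr0.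
  by exists (plen g); apply/asboolP; exists x1 => //; exists g.
case: (ex_minnP Pex) => n /asboolP[x xl [g gn xg]] nmin {Pex}.
have lord y : y \in l -> ord_ge n (val (act y 1)).
  move=> yl h hn; apply: contrapT => yh; move: hn; rewrite ltnNge nmin //.
  by apply/asboolP; exists y => //; exists h.
have lbars y : y \in l -> y * bars g.2 = mulS (act (bars g.2) (act y 1)).
  move=> yl; have [yr _] := lC y yl; rewrite [in LHS]yr; apply: val_inj.
  have gn0 : ord_ge (size g.2 + 0) (val (act y 1)).
    by rewrite addn0 -/(plen g) gn; apply: lord.
  by have [H _] := shifts_bars gn0; apply: H.
have [xr [i ix]] := lC x xl.
pose r := act x 1; pose u := act (bars g.2) r.
have ir : idem i * r = r.
  transitivity (act (mulS (idem i) * x) 1); last by rewrite ix.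
  by rewrite act_mul [X in act X _]xr !act_S_of mul1r.
have iu : idem i * u = u by rewrite -act_idem ir.
have gi : psrc g = i by apply: idem_supp ir xg.
have ug : coef (val u) (trivial_path i) = coef (val r) g.
  by apply: coef_bars; rewrite /= -gi /psrc -surjective_pairing.
pose c := (coef (val r) g)^-1.
(* With m = p_i - c u, the series 1 - m has constant term 1 everywhere and
   p_i (1 - m) = c u. *)
have m1 : ord_ge 1 (val (idem i - c *: u)).
  apply: ord_ge1P => k; rewrite -iu.
  have [->|ki] := eqVneq k i.
    rewrite iu /= eqxx -/(coef _ _) ug mulVf ?subrr //; exact/eqP.
  have -> : coef (val (idem i - c *: (idem i * u))) (trivial_path k) =
    (trivial_path k == trivial_path i)%:R -
    c * coef (val (idem i) * val u) (trivial_path k) by [].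
  rewrite coef_idem_mul /psrc /= (negPf ki) mul0r mulr0 subr0.
  by rewrite -val_eqE /= xpair_eqE (negPf ki).
have [h hR [mh _]] := R_inv (valP (1 - (idem i - c *: u))) (invertible_1B m1).
pose k : RT := exist _ h hR.
have uk : u * (c *: k) = idem i.
  have -> : u * (c *: k) = (c *: u) * k.
    by apply: val_inj; rewrite /= -series_scalerAr series_scalerAl.
  have -> : c *: u = idem i * (1 - (idem i - c *: u)).
    rewrite mulrBr mulr1 mulrBr idem_idem opprB addrCA subrr addr0.
    by apply: val_inj; rewrite /= -series_scalerAr -[in LHS]iu.
  rewrite -mulrA (_ : _ * k = 1) ?mulr1 //; exact: val_inj.
exists x => //; exists (bars g.2 * mulS (c *: k)).
  by rewrite !mulrA lbars // -S_of_mul uk.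
move=> y yl; have [yr [j jy]] := lC y yl; split; last first.
  by exists j; rewrite mulrBr jy mulrA jy.
have -> : y - y * (bars g.2 * mulS (c *: k) * x) =
    mulS (act y 1 - act (bars g.2) (act y 1) * (c *: k) * r).
  by rewrite S_of_sub -yr !S_of_mul -lbars // -xr !mulrA.
by rewrite act_S_of mul1r.
Qed.

(** Two eliminations. On the rows p_i gamma a, with gamma of length n, the
    first makes a regular up to an element b that kills order at least n. The
    second uses the rank one rows q_i gamma b, with gamma shorter. *)
Lemma S_ring_regular : von_neumann_regular S.
Proof.
move=> a; have [n an] := shifts_ex a; have [l [u [ln ex]]] := expansion n.
(* The factor p_i splits the rows by their source; for n = 0 the word
   alone would not do it. *)
have [y ay] : exists y, {in [seq mulS (idem i) * mulS (fwd w) * a |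
    w <- l, i <- enum (vertex E)], forall x, x * (y * a) = x}.
  apply: gauss_elimination R_pivots _ => _ /allpairsP[[w i] /= [wl _ ->]].
  split; last by exists (mulS (idem i) * mulS (fwd w)).
  have wn : ord_ge (n + 0) (val (idem i * fwd w)).
    rewrite addn0 -[n]add0n -(eqP (allP ln w wl)).
    by apply: (ord_geM (ord_ge0 (val (idem i)))); apply: ord_ge_fwd.
  split; last by exists i; rewrite !mulrA -S_of_mul idem_idem.
  rewrite -S_of_mul; have [wa _] := an _ _ wn.
  apply: val_inj; rewrite /= wa; congr rmult.
  by rewrite act_mul act_S_of mul1r.
(* What is left kills the words of length n, so that only the rank one terms
   of the expansion of 1 contribute to b = 1 * b. *)
apply: (@regular_mod _ a y); set b := a - _.
have lb w : w \in l -> mulS (fwd w) * b = 0.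
  move=> wl; rewrite -[mulS (fwd w)]mul1r -sum_idem !mulr_suml big1 // => i _.
  rewrite /b mulrBr -[a * y * a]mulrA [X in _ - X]mulrA ay ?subrr //.
  by apply/allpairsP; exists (w, i); rewrite /= wl mem_enum.
have [z bz] : exists z, {in [seq q i * (mulS (fwd w) * b) |
    w <- u, i <- enum (vertex E)], forall x, x * (z * b) = x}.
  apply: gauss_elimination q_pivots _ => _ /allpairsP[[w i] /= [wu _ ->]].
  split; last by exists (q i * mulS (fwd w)); rewrite mulrA.
  exists i; rewrite mulrA; congr (_ * _); apply: actP => x.
  by rewrite act_mul !act_q /= eqxx mulr1.
exists z.
have bE : b = \sum_(w <- u) \sum_i bars w * (q i * (mulS (fwd w) * b)).
  rewrite -[LHS]mul1r ex mulrDl mulr_suml big1_seq ?add0r => [|w /andP[_ wl]].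
    rewrite mulr_suml; apply: eq_bigr => w _; rewrite mulr_suml.
    by apply: eq_bigr => i _; rewrite !mulrA.
  by rewrite -mulrA lb // mulr0.
rewrite -mulrA {1 3}bE mulr_suml big_seq [RHS]big_seq; apply: eq_bigr => w wu.
rewrite mulr_suml; apply: eq_bigr => i _; rewrite -mulrA bz //.
by apply/allpairsP; exists (w, i); rewrite /= wu mem_enum.
Qed.

End TransductionRingTheory.

Lemma quotient_regular (A : pzRingType) (I : twoSidedIdeal A) :
  von_neumann_regular A -> von_neumann_regular (quotient_ring I).
Proof.
move=> regA x; elim/quotW: x => x; have [y xyx] := regA x.
exists (\pi_(quotient_ring I) y).
by rewrite -[in RHS]xyx !quotient_piM.
Qed.

Theorem theorem2p16 (K : fieldType) (E : quiver) (R : {pred series K E})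
    (R_alg : subalgebra R)
    (R_path : {subset @path_algebra K E <= R})
    (R_inv : inversion_closed R)
    (R_ltr : forall e : arrow E, {homo ltransduction e : f / f \in R})
    (R_rtr : forall e : arrow E, {homo rtransduction e : f / f \in R}) :
  von_neumann_regular (T_ring R_alg R_path R_ltr) /\
  von_neumann_regular (S_ring R_alg R_ltr).
Proof.
have regS : von_neumann_regular (S_ring R_alg R_ltr) by exact: S_ring_regular.
by split=> //; apply: quotient_regular.
Qed.
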